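(* Let $m$ be an even positive integer. Then $$\pounds^{\star}_{\mathcal{A}_2,\{1\}^m}(1/2)=\left(\frac{2^{m+1}-1}{2^{m+1}}\,\frac{B_{p-m-1}}{m+1}\,p\bmod p^2\right)_p\quad\text{in }\mathcal{A}_2.$$
   Context: $\mathcal{A}_2=\left(\prod_p\mathbb{Z}/p^2\mathbb{Z}\right)/\left(\bigoplus_p\mathbb{Z}/p^2\mathbb{Z}\right)$, $p$ running over all primes. Elements are written $(a_p)_p$; two are equal iff their components agree for all but finitely many $p$ (so $a_p$ may be undefined for finitely many $p$). $$\pounds^{\star}_{\mathcal{A}_2,\{1\}^m}(1/2)=\left(\sum_{p-1\ge n_1\ge\cdots\ge n_m\ge1}\frac{1}{n_1\cdots n_m2^{n_1}}\bmod p^2\right)_p\in\mathcal{A}_2.$$ $B_n$ is the $n$-th Bernoulli number, $\frac{te^t}{e^t-1}=\sum_{n\ge0}B_n\frac{t^n}{n!}$. *)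

(* Defs.v *)
From HB Require Import structures.
From mathcomp Require Import all_boot all_order all_algebra.
From mathcomp Require Import boolp classical_sets cardinality.

Set Implicit Arguments.
Unset Strict Implicit.
Unset Printing Implicit Defensive.

Import GRing.Theory.
Local Open Scope ring_scope.
Local Open Scope classical_set_scope.
Local Open Scope quotient_scope.

Definition primeIdx := {p : nat | prime p}.

(* 'Z_n is Z/nZ only for n > 1, which holds for every p ^ 2. *)
Definition prodZp2 := forall p : primeIdx, 'Z_((val p ^ 2)%N).

HB.instance Definition _ := gen_eqMixin prodZp2.
HB.instance Definition _ := gen_choiceMixin prodZp2.

Section ProdRing.
Implicit Types a b c : prodZp2.

Definition prod_zero : prodZp2 := fun=> 0.
Definition prod_one : prodZp2 := fun=> 1.
Definition prod_opp a : prodZp2 := fun p => - a p.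
Definition prod_add a b : prodZp2 := fun p => a p + b p.
Definition prod_mul a b : prodZp2 := fun p => a p * b p.

Lemma prod_addA : associative prod_add.
Proof. by move=> a b c; apply: functional_extensionality_dep => p; apply: addrA. Qed.
Lemma prod_addC : commutative prod_add.
Proof. by move=> a b; apply: functional_extensionality_dep => p; apply: addrC. Qed.
Lemma prod_add0 : left_id prod_zero prod_add.
Proof. by move=> a; apply: functional_extensionality_dep => p; apply: add0r. Qed.
Lemma prod_addN : left_inverse prod_zero prod_opp prod_add.
Proof. by move=> a; apply: functional_extensionality_dep => p; apply: addNr. Qed.

HB.instance Definition _ :=
  GRing.isZmodule.Build prodZp2 prod_addA prod_addC prod_add0 prod_addN.

Lemma prod_mulA : associative prod_mul.
Proof. by move=> a b c; apply: functional_extensionality_dep => p; apply: mulrA. Qed.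
Lemma prod_mulC : commutative prod_mul.
Proof. by move=> a b; apply: functional_extensionality_dep => p; apply: mulrC. Qed.
Lemma prod_mul1 : left_id prod_one prod_mul.
Proof. by move=> a; apply: functional_extensionality_dep => p; apply: mul1r. Qed.
Lemma prod_mulDl : left_distributive prod_mul prod_add.
Proof. by move=> a b c; apply: functional_extensionality_dep => p; apply: mulrDl. Qed.
Lemma prod_1neq0 : prod_one != 0 :> prodZp2.
Proof.
apply/eqP => /(congr1 (fun a : prodZp2 => a (exist _ 2%N isT))).
by move/eqP; rewrite oner_eq0.
Qed.

HB.instance Definition _ := GRing.Zmodule_isComNzRing.Build prodZp2
  prod_mulA prod_mulC prod_mul1 prod_mulDl prod_1neq0.

End ProdRing.

Lemma prod_addE (a b : prodZp2) p : (a + b) p = a p + b p. Proof. by []. Qed.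
Lemma prod_oppE (a : prodZp2) p : (- a) p = - a p. Proof. by []. Qed.
Lemma prod_mulE (a b : prodZp2) p : (a * b) p = a p * b p. Proof. by []. Qed.

Lemma infinite_primeIdx : ~ finite_set [set: primeIdx].
Proof.
move=> /(finite_image (fun p : primeIdx => val p)).
move=> /finite_seqP[s sE].
have [p ltp pr_p] := prime_above (\max_(q <- s) q).
have : [set` s] p by rewrite -sE; exists (exist _ p pr_p).
by move=> /= /(@leq_bigmax_seq _ _ xpredT id) => /(_ isT); rewrite leqNgt ltp.
Qed.

Definition dirsumZp2 : {pred prodZp2} :=
  fun a => `[< finite_set [set p | a p <> 0] >].

Lemma dirsumZp2P (a : prodZp2) :
  reflect (finite_set [set p | a p <> 0]) (a \in dirsumZp2).
Proof. exact: asboolP. Qed.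

Lemma dirsumZp2_idealr : idealr_closed dirsumZp2.
Proof.
split.
- by apply/dirsumZp2P; apply: sub_finite_set (finite_set0 _) => p /=.
- apply/negP => /dirsumZp2P fin1; apply: infinite_primeIdx.
  by apply: sub_finite_set fin1 => p _ /=; apply/eqP; rewrite oner_eq0.
- move=> a u v /dirsumZp2P finu /dirsumZp2P finv; apply/dirsumZp2P.
  apply: (@sub_finite_set _ _ ([set p | u p <> 0] `|` [set p | v p <> 0])).
    move=> p /= auv; have [u0|] := pselect (u p = 0); last by left.
    right=> v0; apply: auv.
    by rewrite prod_addE prod_mulE u0 v0 mulr0 addr0.
  by rewrite finite_setU.
Qed.

HB.instance Definition _ := isIdealr.Build prodZp2 dirsumZp2 dirsumZp2_idealr.

Definition A2 := {ideal_quot dirsumZp2}.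
HB.instance Definition _ := GRing.ComNzRing.on A2.

Definition A2_of (a : prodZp2) : A2 := \pi_{ideal_quot dirsumZp2} a.

Lemma A2_eqP (a b : prodZp2) :
  A2_of a = A2_of b <-> finite_set [set p | a p <> b p].
Proof.
have -> : [set p | a p <> b p] = [set p | (a - b) p <> 0].
  apply/seteqP; split=> p /=; rewrite prod_addE prod_oppE => ab0 ab; apply: ab0.
    by apply/eqP; rewrite -subr_eq0; apply/eqP.
  by rewrite ab subrr.
rewrite /A2_of; split=> [/eqP|/dirsumZp2P ab].
  by rewrite -Quotient.idealrBE => /dirsumZp2P.
by apply/eqP; rewrite -Quotient.idealrBE.
Qed.

(* The class (r_p mod p ^ 2)_p of a family of rational numbers.  For r whose
   denominator is prime to p, ratr r is the reduction of r modulo p ^ 2; when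
   p divides the denominator the component is an arbitrary value, which is
   harmless as long as this happens for finitely many p only. *)
Definition A2_of_rat (r : nat -> rat) : A2 :=
  A2_of (fun p : primeIdx => ratr (r (val p))).

(* The index (n_1, ..., n_m) is the tuple n; p - 1 >= n_1 is built into 'I_p. *)
Definition polylog_star_half_trunc (m p : nat) : rat :=
  \sum_(n : m.-tuple 'I_p |
        sorted geq [seq val i | i <- n] && all (fun i : 'I_p => 0 < i)%N n)
    1 / ((\prod_(i <- n) (val i)%:R) * 2 ^+ head 0%N [seq val i | i <- n]).

Definition polylog_star_half (m : nat) : A2 :=
  A2_of_rat (polylog_star_half_trunc m).

(* Formal power series over rat, as sequences of coefficients. *)
Definition fps_mul (f g : nat -> rat) : nat -> rat :=
  fun n => \sum_(i < n.+1) f i * g (n - i)%N.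
Definition fps_one : nat -> rat := fun n => (n == 0%N)%:R.
Definition fps_X : nat -> rat := fun n => (n == 1%N)%:R.
Definition fps_exp : nat -> rat := fun n => (n`!%:R)^-1.

Definition fps_expB1 : nat -> rat := fun n => fps_exp n - fps_one n.

(* (sum_n B_n t^n / n!) * (e^t - 1) = t * e^t *)
Definition is_bernoulli (B : nat -> rat) : Prop :=
  fps_mul (fun n => B n / n`!%:R) fps_expB1 =1 fps_mul fps_X fps_exp.

Section Bernoulli.
Variables g h : nat -> rat.
Hypotheses (g0 : g 0%N = 0) (g1 : g 1%N = 1) (h0 : h 0%N = 0).

Lemma fps_divE (f : nat -> rat) :
  fps_mul f g =1 h <->
  forall n, f n = h n.+1 - \sum_(i < n) f i * g (n.+1 - i)%N.
Proof.
have E n : fps_mul f g n.+1 = \sum_(i < n) f i * g (n.+1 - i)%N + f n.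
  by rewrite /fps_mul !big_ord_recr /= subnn g0 mulr0 addr0 subSnn g1 mulr1.
split=> [fg n|fE [|n]]; first by rewrite -fg E addrAC subrr add0r.
  by rewrite /fps_mul big_ord1 g0 mulr0 h0.
by rewrite E fE addrC subrK.
Qed.

Fixpoint fps_div_seq n : seq rat :=
  if n is n'.+1 then
    let s := fps_div_seq n' in
    rcons s (h n - \sum_(i < n') s`_i * g (n - i)%N)
  else [::].

Lemma fps_div_ex : {f : nat -> rat | fps_mul f g =1 h}.
Proof.
pose f n := (fps_div_seq n.+1)`_n; exists f.
have sz n : size (fps_div_seq n) = n.
  by elim: n => //= n IHn; rewrite size_rcons IHn.
have nthE n i : (i < n)%N -> (fps_div_seq n)`_i = f i.
  elim: n => // n IHn; rewrite ltnS leq_eqVlt => /orP[/eqP->//|lt_in].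
  by rewrite /= nth_rcons sz lt_in IHn.
apply/fps_divE => n.
rewrite {1}/f /= nth_rcons sz ltnn eqxx; congr (_ - _).
by apply: eq_bigr => i _; rewrite nthE.
Qed.

Lemma fps_div_uniq (f f' : nat -> rat) :
  fps_mul f g =1 h -> fps_mul f' g =1 h -> f =1 f'.
Proof.
move=> /fps_divE fE /fps_divE f'E n.
elim/ltn_ind: n => n IHn; rewrite fE f'E; congr (_ - _).
by apply: eq_bigr => i _; rewrite IHn.
Qed.

End Bernoulli.

Lemma natf_neq0_rat n : n`!%:R != 0 :> rat.
Proof. by rewrite Num.Theory.pnatr_eq0 -lt0n fact_gt0. Qed.

Lemma fps_expB1_0 : fps_expB1 0 = 0. Proof. by []. Qed.
Lemma fps_expB1_1 : fps_expB1 1 = 1. Proof. by []. Qed.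
Lemma fps_Xexp_0 : fps_mul fps_X fps_exp 0 = 0.
Proof. by rewrite /fps_mul big_ord1 mul0r. Qed.

Lemma bernoulli_ex : {B : nat -> rat | is_bernoulli B}.
Proof.
have [f fE] := fps_div_ex fps_expB1_0 fps_expB1_1 fps_Xexp_0.
exists (fun n => f n * n`!%:R) => n; rewrite -fE.
by apply: eq_bigr => i _; rewrite mulfK ?natf_neq0_rat.
Qed.

Definition bernoulli : nat -> rat := sval bernoulli_ex.

Lemma bernoulliP : is_bernoulli bernoulli.
Proof. exact: svalP bernoulli_ex. Qed.

Lemma bernoulli_uniq (B : nat -> rat) : is_bernoulli B -> B =1 bernoulli.
Proof.
move=> BE n.
have := fps_div_uniq fps_expB1_0 fps_expB1_1 fps_Xexp_0 BE bernoulliP n.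
by move/(mulIf (invr_neq0 (natf_neq0_rat n))).
Qed.

(* Main.v *)
Require Import Defs.
From HB Require Import structures.
From mathcomp Require Import all_boot all_order all_algebra.
From mathcomp Require Import classical_sets cardinality.
From mathcomp Require Import ring zify.
Import Order.TTheory GRing.Theory Num.Theory.
Local Open Scope ring_scope.

(** Fix m even and a large prime p, put b = B_(p-m-1), S = sum k^-m and
    D = sum over even k of k^-m, with 1 <= k < p throughout.  All congruences
    are between p-integral rationals.

    Exact identity.  The inner sums of the star polylogarithm are the nested
    harmonic sums h_r(n), and h_r(n) = - sum_k (-1)^k C(n,k) / k^r
    (star_harmonic_binomial).  Exchanging the summations, the weights
    2^-n C(n-1,k-1) add up to a tail of a binomial distribution, so that the
    truncated value at 1/2 is
      - 2^-(p-1) sum_k Q_k / k^m,  Q_k = (-1)^k sum_(j >= k) C(p-1,j)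
    (star_half_tail).

    The tail modulo p^2.  Since (-1)^k C(p-1,k) = 1 - p H_k mod p^2, one has
    Q_k + Q_(k+1) = 1 - p H_k.  Modulo p the harmonic number H_k is Phi(k),
    where Phi is the Faulhaber polynomial of exponent p-2, because
    1/j = j^(p-2).  If F(x) = Phi((x-1)/2) up to a constant, then
    F(k) + F(k+1) = Phi(k/2) + Phi((k-1)/2) + const = 2 Phi(k) + const,
    which solves the recurrence:
      Q_k = 1/2 + (-1)^k / 2 - p (F(k)/2 + const)
    (signed_tail_mod; the coefficient 1/2 of (-1)^k is only known modulo p,
    which is enough as it multiplies a sum divisible by p).  Hence
      - sum_k Q_k / k^m = - D + p/2 sum_k F(k) / k^m  mod p^2.

    The order p term.  Modulo p, sum_k F(k) k^-m picks minus the coefficient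
    of x^m in F, a Bernoulli number: it is (2 - 2^-m) b (sum_half_faulhaber).

    The even sum.  Replacing k by 2k permutes the residues modulo p; keeping
    track of the carries modulo p^2 (doubling_sums) relates S, D and the sum E
    of k^-(m+1) over even k.  The same relation for the exponent p-1-m, where
    Faulhaber's formula gives the power sum p b, evaluates E modulo p.
    Together D = (1 - 2^-(m+1)) S and (m+1) S = m p b (inv_power_sums).

    Adding up, the value is (1 - 2^-(m+1)) p b (1 - m/(m+1)), as claimed.  The
    factor 2^-(p-1) is 1 modulo p and multiplies a multiple of p. *)

(** * The ideals p^e Z_(p) of the p-integral rationals *)

(** The ideal p^e Z_(p), so that x = y mod p^e reads x - y \in pmult p e.
    Coprimality of p to the denominator, rather than non-divisibility, makes it
    a subgroup for every natural number p, prime or not, as the canonical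
    structure below requires. *)
Definition pmult (p e : nat) : {pred rat} :=
  fun x => coprime p `|denq (x / p%:R ^+ e)|.

Lemma coprime_denq_frac (p d : nat) (a : int) :
  coprime p d -> coprime p `|denq (a%:~R / d%:R)|.
Proof.
have [->|d0] := eqVneq d 0%N.
  by rewrite invr0 mulr0 => _; rewrite coprimen1.
apply: coprime_dvdr; set x := _ / _.
have xE : numq x * d%:Z = a * denq x.
  apply/eqP; rewrite -(eqr_int rat) !rmorphM /= -[d%:~R]/(d%:R).
  rewrite -[x in (numq x)%:~R](divq_num_den x).
  have xd : x * d%:R = a%:~R by rewrite divfK // pnatr_eq0.
  have xn : x * (denq x)%:~R = (numq x)%:~R.
    by rewrite -{1}[x]divq_num_den divfK // intr_eq0 denq_neq0.
  by rewrite divq_num_den -xn -xd; apply/eqP; ring.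
have : (denq x %| numq x * d%:Z)%Z by rewrite xE dvdz_mull.
by rewrite Gauss_dvdzr ?coprimezE 1?coprime_sym ?coprime_num_den.
Qed.

Lemma pmultP p e x : x \in pmult p e ->
  exists a d, coprime p d /\ x / p%:R ^+ e = a%:~R / d%:R.
Proof.
rewrite unfold_in /pmult => cop.
exists (numq (x / p%:R ^+ e)), `|denq (x / p%:R ^+ e)|%N.
by split=> //; rewrite -{1}[_ / _]divq_num_den -[`|_|%N%:R]/(`|_|%N%:~R) absz_denq.
Qed.

Lemma pmult_zmod p e : zmod_closed (pmult p e).
Proof.
split=> [|x y /pmultP[a [b [pb xE]]] /pmultP[c [d [pd yE]]]].
  by rewrite unfold_in /pmult mul0r coprimen1.
rewrite unfold_in /pmult mulrBl xE yE.
have pbd : coprime p (b * d) by rewrite coprimeMr pb.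
have [b0|b0] := eqVneq b 0%N.
  rewrite b0 invr0 mulr0 sub0r -mulNr -mulrNz; exact: coprime_denq_frac.
have [d0|d0] := eqVneq d 0%N.
  by rewrite d0 invr0 mulr0 subr0; apply: coprime_denq_frac.
rewrite (_ : _ - _ = (a * d%:Z - c * b%:Z)%:~R / (b * d)%N%:R).
  exact: coprime_denq_frac.
rewrite rmorphB !rmorphM /=.

by field; rewrite !pnatr_eq0 b0 d0.
Qed.

HB.instance Definition _ p e := GRing.isZmodClosed.Build rat (pmult p e) (pmult_zmod p e).

Lemma pmultM p e f x y :
  x \in pmult p e -> y \in pmult p f -> x * y \in pmult p (e + f).
Proof.
move=> /pmultP[a [b [pb xE]]] /pmultP[c [d [pd yE]]].
rewrite unfold_in /pmult exprD invfM mulrACA xE yE mulrACA -intrM -invfM -natrM.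
by apply: coprime_denq_frac; rewrite coprimeMr pb.
Qed.

Lemma pmult_int p (a : int) : a%:~R \in pmult p 0.
Proof.
rewrite unfold_in /pmult divr1 -[_%:~R]divr1.
by apply: (coprime_denq_frac p 1 a); rewrite coprimen1.
Qed.

Lemma pmult_nat p (n : nat) : n%:R \in pmult p 0.
Proof. exact: pmult_int p n. Qed.

Lemma pmult1 p : 1 \in pmult p 0. Proof. exact: pmult_nat p 1. Qed.

Lemma pmult_invn p (n : nat) : coprime p n -> n%:R^-1 \in pmult p 0.
Proof.
move=> pn; rewrite unfold_in /pmult divr1 -[_^-1]mul1r.
exact: (coprime_denq_frac p n 1).
Qed.

Lemma pmult_self p e : p%:R ^+ e \in pmult p e.
Proof.
rewrite unfold_in /pmult; have [->|n0] := eqVneq (p%:R ^+ e : rat) 0.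
  by rewrite mul0r coprimen1.
by rewrite divff ?coprimen1.
Qed.

Lemma pmultMl p e x y : x \in pmult p 0 -> y \in pmult p e -> x * y \in pmult p e.
Proof. by move=> xp yp; have := pmultM p 0 e x y xp yp. Qed.

Lemma pmultMr p e x y : x \in pmult p e -> y \in pmult p 0 -> x * y \in pmult p e.
Proof. by move=> xp yp; rewrite mulrC pmultMl. Qed.

Lemma pmultX p n x : x \in pmult p 0 -> x ^+ n \in pmult p 0.
Proof. by move=> xp; elim: n => [|n IH]; rewrite ?pmult1 // exprS pmultMl. Qed.

Lemma pmultW p e x : (0 < p)%N -> x \in pmult p e.+1 -> x \in pmult p e.
Proof.
move=> p0 /pmultP[a [d [pd xE]]]; rewrite unfold_in /pmult.
have p0' : p%:R != 0 :> rat by rewrite pnatr_eq0 -lt0n.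
rewrite (_ : x / _ = (p%:Z * a)%:~R / d%:R) ?coprime_denq_frac //.
rewrite intrM -mulrA -xE exprS -[p%:~R]/(p%:R).
by field; rewrite p0' expf_neq0.
Qed.

(** Lets a congruence be proved as an explicit linear combination of known
    ones, the leftover equality being left to ring or field. *)
Lemma pmult_eq p e x y : x \in pmult p e -> x = y -> y \in pmult p e.
Proof. by move=> ? <-. Qed.

(** Closes p-integrality goals for polynomial expressions in integers. *)
Ltac pint := repeat first
  [ assumption | exact: pmult_nat | exact: pmult1 | apply: pmultX | rewrite rpredN
  | apply: pmultMl | apply: rpredD | apply: rpred_sum => ? _ ].

(** * Fermat's theorem and first-order expansions *)

Lemma coprime_small p k : prime p -> (0 < k < p)%N -> coprime p k.
Proof.
move=> pp /andP[k0 kp]; rewrite prime_coprime //.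
by apply/negP => /(dvdn_leq k0); rewrite leqNgt kp.
Qed.

Lemma pmult_inv_small p k : prime p -> (0 < k < p)%N -> k%:R^-1 \in pmult p 0.
Proof. by move=> pp kp; rewrite pmult_invn ?coprime_small. Qed.

Lemma pmult_dvd p n : (p %| n)%N -> n%:R \in pmult p 1.
Proof.
case/dvdnP=> q ->; rewrite natrM; apply: pmultMl; first exact: pmult_nat.
exact: (pmult_self p 1).
Qed.

Lemma pmult_fermat p k : prime p -> (0 < k < p)%N ->
  k%:R ^+ p.-1 - 1 \in pmult p 1.
Proof.
move=> pp kp; have k0 : k%:R != 0 :> rat.
  by rewrite pnatr_eq0 -lt0n; case/andP: kp.
have kk : (k <= k ^ p)%N.
  by case/andP: kp => k0' _; rewrite -{1}(expn1 k) leq_pexp2l ?(prime_gt0 pp).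
have : (k ^ p - k)%:R \in pmult p 1.
  by apply: pmult_dvd; rewrite -eqn_mod_dvd // fermat_little.
move/(pmultMl p 1 k%:R^-1 _ (pmult_inv_small p k pp kp)).
by rewrite natrB // natrX -{1}(prednK (prime_gt0 pp)) exprS mulrBr mulKf // mulVf.
Qed.

Lemma pmult_taylor p (x h : rat) n : x \in pmult p 0 -> h \in pmult p 1 ->
  x + h \in pmult p 0 ->
  (x + h) ^+ n - x ^+ n - n%:R * h * x ^+ n.-1 \in pmult p 2.
Proof.
move=> xp hp xhp; elim: n => [|n IH]; first by rewrite !expr0 !mul0r subr0 subrr rpred0.
have E : n%:R * x ^+ n = n%:R * (x * x ^+ n.-1).
  by case: n {IH} => [|n]; rewrite ?mul0r //= exprS.
rewrite (_ : _ - _ = (x + h) * ((x + h) ^+ n - x ^+ n - n%:R * h * x ^+ n.-1)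
     + h * (h * (n%:R * x ^+ n.-1))).
  apply: rpredD; first exact: pmultMl.
  by rewrite mulrA; apply: pmultMr (pmultM p 1 1 _ _ hp hp) _; pint.
rewrite /= !exprS -(natr1 n).
apply/eqP; rewrite -subr_eq0; apply/eqP.
transitivity (- h * (n%:R * x ^+ n - n%:R * (x * x ^+ n.-1))); first by ring.
by rewrite E subrr mulr0.
Qed.

(** Write (x + h)^-1 = x^-1 + h' with h' = - h x^-1 (x + h)^-1, again a
    multiple of p, and expand the n-th power of that sum. *)
Lemma pmult_taylorV p (x h : rat) n : x != 0 -> x + h != 0 -> h \in pmult p 1 ->
  x^-1 \in pmult p 0 -> (x + h)^-1 \in pmult p 0 ->
  (x + h) ^- n - x ^- n + n%:R * h * x ^- n.+1 \in pmult p 2.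
Proof.
move=> x0 xh0 hp xp xhp; set y := (x + h)^-1; set u := x^-1.
have yE : y = u + - h * u * y by rewrite /y /u; field; rewrite ?x0 ?xh0.
have h'p : - h * u * y \in pmult p 1 by do 2![apply: pmultMr => //]; rewrite rpredN.
have := pmult_taylor p u (- h * u * y) n xp h'p; rewrite -yE => /(_ xhp) T.
rewrite -!exprVn -/y -/u.
rewrite (_ : _ + _ = (y ^+ n - u ^+ n - n%:R * (- h * u * y) * u ^+ n.-1)
  + h * h * (u * u * y * n%:R * u ^+ n.-1)).
  apply: rpredD => //; apply: pmultMr; first exact: (pmultM p 1 1).
  by pint.
have E : n%:R * u ^+ n = n%:R * (u * u ^+ n.-1).
  by case: n {T} => [|n]; rewrite ?mul0r //= exprS.
have -> : n%:R * h * u ^+ n.+1 = h * u * (n%:R * u ^+ n) by rewrite exprS; ring.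
apply/eqP; rewrite -subr_eq0 E; apply/eqP.
transitivity (h * u * n%:R * u ^+ n.-1 * (u + - h * u * y - y)); first by ring.
by rewrite -yE subrr mulr0.
Qed.

(** * Bernoulli numbers and Faulhaber polynomials *)

(** The coefficient of t^(n+1) in the defining identity of the generating
    function, times (n+1)!. *)
Lemma bernoulli_rec n :
  \sum_(i < n.+1) 'C(n.+1, i)%:R * bernoulli i = n.+1%:R.
Proof.
have := bernoulliP n.+1; rewrite /fps_mul [LHS]big_ord_recr /= subnn.
rewrite /fps_expB1 /fps_exp /fps_one /= invr1 subrr mulr0 addr0.
rewrite [RHS](bigD1 (lift ord0 ord0)) //= mul1r [X in _ = _ + X]big1 ?addr0; last first.
  move=> i; rewrite -val_eqE /fps_X /= => /negPf ->; exact: mul0r.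
move/(congr1 (fun x => n.+1`!%:R * x)); rewrite subSS subn0.
have fn0 k : k`!%:R != 0 :> rat by exact: natf_neq0_rat.
rewrite [RHS](_ : _ = n.+1%:R); last by rewrite factS natrM mulfK.
move=> <-; rewrite mulr_sumr; apply: eq_bigr => i _ /=.
have -> : (n.+1 - i == 0)%N = false by rewrite subn_eq0 leqNgt ltn_ord.
have := bin_fact (ltnW (ltn_ord i)) => /(congr1 (fun x => x%:R : rat)).
rewrite !natrM subr0 => <-.
by field; rewrite !fn0.
Qed.

(** In this range the recursion only divides by integers n + 1 < p. *)
Lemma pmult_bernoulli p n : prime p -> (n.+1 < p)%N -> bernoulli n \in pmult p 0.
Proof.
move=> pp; elim/ltn_ind: n => n IH np.
have := bernoulli_rec n; rewrite big_ord_recr /= binSn => /(canRL (addKr _)) E.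
rewrite -[bernoulli n](mulKf (_ : n.+1%:R != 0)) ?pnatr_eq0 // E.
rewrite pmultMl ?pmult_inv_small // rpredD ?pmult_nat // rpredN rpred_sum // => i _.
apply: pmultMl; first exact: pmult_nat.
by apply: IH => //; apply: leq_ltn_trans np; rewrite ltnS ltnW.
Qed.

(** The polynomial with value 1^n + ... + N^n at N, taken as a function on all
    rationals since its values at half-integers matter too. *)
Definition faulhaber (n : nat) (x : rat) : rat :=
  (\sum_(i < n.+1) 'C(n.+1, i)%:R * bernoulli i * x ^+ (n.+1 - i)) / n.+1%:R.

(** Both sides count the pairs of disjoint subsets of sizes i and l. *)
Lemma bin_trinomial (n i l : nat) : (i + l <= n)%N ->
  ('C(n, i) * 'C(n - i, l) = 'C(n, l) * 'C(n - l, i))%N.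
Proof.
move=> le; have f k := fact_gt0 k.
apply/eqP; rewrite -(eqn_pmul2r (f i)) -(eqn_pmul2r (f l)).
rewrite -(eqn_pmul2r (f (n - i - l)%N)).
have -> : ('C(n, i) * 'C(n - i, l) * i`! * l`! * (n - i - l)`! =
  'C(n, i) * (i`! * ('C(n - i, l) * (l`! * (n - i - l)`!))))%N by lia.
rewrite bin_fact ?leq_subRL ?bin_fact; try lia.
have -> : ('C(n, l) * 'C(n - l, i) * i`! * l`! * (n - i - l)`! =
  'C(n, l) * (l`! * ('C(n - l, i) * (i`! * (n - l - i)`!))))%N.
  by rewrite subnAC; lia.
rewrite bin_fact ?leq_subRL ?bin_fact; lia.
Qed.

(** Expand the powers of x + 1 and exchange the sums: by bin_trinomial the
    coefficient of x^l is C(n+1,l) times a full Bernoulli recursion. *)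
Lemma faulhaberS n (x : rat) : faulhaber n (x + 1) = faulhaber n x + (x + 1) ^+ n.
Proof.
suff H : faulhaber n (x + 1) - faulhaber n x = (x + 1) ^+ n.
  by rewrite -H [RHS]addrC subrK.
have n0 : n.+1%:R != 0 :> rat by rewrite pnatr_eq0.
apply: (mulIf n0); rewrite /faulhaber mulrBl !divfK // -sumrB.
transitivity (\sum_(i < n.+1) \sum_(l < n.+1 | (i + l < n.+1)%N)
   ('C(n.+1, i) * 'C(n.+1 - i, l))%:R * bernoulli i * x ^+ l).
  apply: eq_bigr => i _; rewrite -mulrBr (addrC x 1) exprDn big_ord_recr /=.
  rewrite subnn binn mulr1n expr1n mul1r addrK mulr_sumr.
  have lei : (n.+1 - i <= n.+1)%N by rewrite leq_subr.
  rewrite (big_ord_widen _ (fun l => 'C(n.+1, i)%:R * bernoulli i *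
    (1 ^+ (n.+1 - i - l) * x ^+ l *+ 'C(n.+1 - i, l))) lei).
  apply: eq_big => l; first by rewrite ltn_subRL.
  by move=> _; rewrite expr1n mul1r natrM -mulr_natl; ring.
rewrite (exchange_big_dep predT) //=.
rewrite (addrC x 1) exprDn mulr_suml; apply: eq_bigr => l _.
rewrite expr1n mul1r.
have := bernoulli_rec (n - l)%N; rewrite -subSn; last by rewrite -ltnS.
move=> R; transitivity (x ^+ l * 'C(n.+1, l)%:R * (n.+1 - l)%:R).
  rewrite -{}R mulr_sumr.
  have lel : (n.+1 - l <= n.+1)%N by rewrite leq_subr.
  rewrite (big_ord_widen _ (fun i =>
    x ^+ l * 'C(n.+1, l)%:R * ('C(n.+1 - l, i)%:R * bernoulli i)) lel).
  apply: eq_big => i; first by rewrite ltn_subRL addnC.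
  by move=> H; rewrite bin_trinomial 1?ltnW // natrM; ring.
rewrite -mulrA -natrM mulnC -mul_bin_down mulnC natrM mulrA /=; congr (_ * _).
by rewrite mulr_natr.
Qed.

Lemma faulhaber0 n : faulhaber n 0 = 0.
Proof.
rewrite /faulhaber big1 ?mul0r // => i _.
by rewrite subSn ?exprS ?mul0r ?mulr0 // -ltnS.
Qed.

Lemma faulhaber_sum n N : \sum_(1 <= k < N.+1) k%:R ^+ n = faulhaber n N%:R.
Proof.
elim: N => [|N IH]; first by rewrite big_geq ?faulhaber0.
by rewrite big_nat_recr //= IH -natr1 faulhaberS.
Qed.

(** * Power sums modulo p and p^2 *)

(** All terms but the linear one, B_n x, carry a factor p^2 at x = p. *)
Lemma pmult_faulhaber_p p n : prime p -> (n.+1 < p)%N ->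
  faulhaber n p%:R - p%:R * bernoulli n \in pmult p 2.
Proof.
move=> pp np; rewrite /faulhaber big_ord_recr /= subSnn binSn mulrDl.
rewrite (_ : n.+1%:R * _ * _ / _ = p%:R * bernoulli n); last first.
  have : n.+1%:R != 0 :> rat by rewrite pnatr_eq0.
  by move: n.+1%:R => c c0; field.
rewrite addrK mulrC pmultMl ?pmult_inv_small //; apply: rpred_sum => i _.
have -> : (n.+1 - i = 2 + (n - i).-1)%N by have := ltn_ord i; lia.
rewrite exprD mulrA; apply: pmultMr; last by pint.
apply: pmultMl; last exact: pmult_self.
apply: pmultMl; first exact: pmult_nat.
by apply: pmult_bernoulli => //; apply: leq_ltn_trans np; rewrite ltnS ltnW.
Qed.

Lemma power_sum_faulhaber p n : prime p ->
  \sum_(1 <= k < p) k%:R ^+ n = faulhaber n p%:R - p%:R ^+ n.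
Proof.
move=> pp; rewrite -faulhaber_sum big_nat_recr ?prime_gt0 //=.
by rewrite addrK.
Qed.

Lemma power_sum_bernoulli p n : prime p -> (1 < n)%N -> (n.+1 < p)%N ->
  \sum_(1 <= k < p) k%:R ^+ n - p%:R * bernoulli n \in pmult p 2.
Proof.
move=> pp n1 np; rewrite power_sum_faulhaber // addrAC rpredB ?pmult_faulhaber_p //.
rewrite -(subnKC n1) exprD; apply: pmultMr; first exact: pmult_self.
by pint.
Qed.

Lemma power_sum_mod p n : prime p -> (0 < n)%N -> (n.+1 < p)%N ->
  \sum_(1 <= k < p) k%:R ^+ n \in pmult p 1.
Proof.
move=> pp n0 np; rewrite power_sum_faulhaber // rpredB //.
  rewrite -(subrK (p%:R * bernoulli n) (faulhaber _ _)) rpredD //.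
    by apply: pmultW (pmult_faulhaber_p _ _ pp np); rewrite prime_gt0.
  by apply: pmultMr; [exact: (pmult_self p 1)|exact: pmult_bernoulli].
rewrite -(subnKC n0) exprD; apply: pmultMr; first exact: pmult_self.
by pint.
Qed.

(** The exponent i - m lies strictly between -(p-1) and p-1, so it is a multiple
    of p - 1 only if it is 0.  Summing F(k) k^-m thus extracts, up to sign, the
    coefficient of x^m in a polynomial F of degree less than p. *)
Lemma power_sum_ratio p i m : prime p -> (0 < m)%N -> (m.+1 < p)%N -> (i < p)%N ->
  \sum_(1 <= k < p) k%:R ^+ i / k%:R ^+ m + (i == m)%:R \in pmult p 1.
Proof.
move=> pp m0 mp ip.
have k0 k : (0 < k < p)%N -> k%:R != 0 :> rat.
  by rewrite pnatr_eq0 -lt0n => /andP[].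
case: (ltngtP i m) => im; last 1 first.
- rewrite im (eq_big_nat _ _ (F2 := fun=> 1)) => [|k kp]; last first.
    by rewrite divff // expf_neq0 ?k0.
  rewrite sumr_const_nat natr1 subn1 prednK ?prime_gt0 //.
  exact: (pmult_self p 1).
- rewrite addr0 -[X in X \in _](subrK (\sum_(1 <= k < p) k%:R ^+ (p.-1 - (m - i)))).
  apply: rpredD; last by apply: power_sum_mod => //; lia.
  rewrite -sumrB big_nat; apply: rpred_sum => k kp.
  rewrite (_ : _ - _ = - (k%:R^-1 ^+ (m - i) * (k%:R ^+ p.-1 - 1))); last first.
    have -> : (p.-1 = p.-1 - (m - i) + (m - i))%N by lia.
    have kk := k0 k kp; rewrite addnK exprD exprVn -{1}(subnK (ltnW im)) exprD.
    by field; rewrite ?expf_neq0.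
  by rewrite rpredN pmultMl ?pmult_fermat // pmultX // pmult_inv_small.
- rewrite addr0 (eq_big_nat _ _ (F2 := fun k => k%:R ^+ (i - m))) => [|k kp].
    by apply: power_sum_mod => //; lia.
  by rewrite -{1}(subnK (ltnW im)) exprD mulfK // expf_neq0 ?k0.
Qed.

(** * The doubling relation *)

(** The odd numbers below p = 2h + 1 are the p - 2j. *)
Lemma sum_parity_split h (G : nat -> rat) :
  \sum_(1 <= k < (2 * h).+1) G k =
  \sum_(1 <= j < h.+1) G (2 * j)%N + \sum_(1 <= j < h.+1) G ((2 * h).+1 - 2 * j)%N.
Proof.
rewrite [X in _ = _ + X]big_nat_rev /=.
rewrite [X in _ = _ + X](eq_big_nat _ _ (F2 := fun j => G (2 * j - 1))%N); last first.
  by move=> j /andP[j0 jh]; congr G; lia.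
rewrite -big_split /=; elim: h => [|h IH]; first by rewrite !big_geq.
have -> : (2 * h.+1 = (2 * h).+2)%N by lia.
rewrite !(big_nat_recr (2 * h).+2) // big_nat_recr //= IH [RHS]big_nat_recr //=.
have -> : (2 * h.+1 = (2 * h).+2)%N by lia.
by rewrite subn1 -addrA (addrC (G (2 * h).+1)).
Qed.

(** For k > h, 2k is p plus an odd number p - 2j, hence of the form 2p - 2j. *)
Lemma sum_double_split h (G : nat -> rat) :
  \sum_(1 <= k < (2 * h).+1) G (2 * k)%N =
  \sum_(1 <= j < h.+1) G (2 * j)%N +
  \sum_(1 <= j < h.+1) G (2 * (2 * h).+1 - 2 * j)%N.
Proof.
rewrite (big_cat_nat _ (n := h.+1)) //=; last by lia.
congr (_ + _); rewrite [RHS]big_nat_rev /= -[X in \sum_(X <= _ < _) _]add1n big_addn.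
have -> : ((2 * h).+1 - h = h.+1)%N by lia.
by apply: eq_big_nat => j /andP[j0 jh]; congr G; lia.
Qed.

(** The two congruences come from sum_parity_split applied to g and
    sum_double_split applied to c g(k) = g(2k).  The hypothesis on g is the
    first-order expansion of an even function g with derivative g' from 2j to
    2j - t p. *)
Lemma doubling_sums p h c (g g' : nat -> rat) : p = (2 * h).+1 ->
  (forall k, g (2 * k)%N = c * g k) ->
  (forall t j, (0 < t < 3)%N -> (0 < j < h.+1)%N ->
     g (t * p - 2 * j)%N - g (2 * j)%N + t%:R * p%:R * g' (2 * j)%N \in pmult p 2) ->
  \sum_(1 <= k < p) g k - 2 * \sum_(1 <= j < h.+1) g (2 * j)%N
    + p%:R * \sum_(1 <= j < h.+1) g' (2 * j)%N \in pmult p 2 /\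
  c * \sum_(1 <= k < p) g k - 2 * \sum_(1 <= j < h.+1) g (2 * j)%N
    + 2 * p%:R * \sum_(1 <= j < h.+1) g' (2 * j)%N \in pmult p 2.
Proof.
move=> pE g2 gT.
set S := \sum_(1 <= k < p) g k.
set D := \sum_(1 <= j < h.+1) g (2 * j)%N.
set E := \sum_(1 <= j < h.+1) g' (2 * j)%N.
have T t : (0 < t < 3)%N ->
    \sum_(1 <= j < h.+1) g (t * p - 2 * j)%N - D + t%:R * p%:R * E \in pmult p 2.
  move=> t12; rewrite /D /E -sumrB mulr_sumr -big_split /= big_nat.
  by apply: rpred_sum => j jh; apply: gT.
split.
  apply: pmult_eq (T 1%N isT) _; rewrite mul1n mul1r.
  have -> : S = D + \sum_(1 <= j < h.+1) g (p - 2 * j)%N.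
    by rewrite /S pE sum_parity_split.
  ring.
apply: pmult_eq (T 2%N isT) _.
have -> : c * S = D + \sum_(1 <= j < h.+1) g (2 * p - 2 * j)%N.
  rewrite /S mulr_sumr -(eq_bigr _ (fun k _ => g2 k)).
  by rewrite pE sum_double_split.
ring.
Qed.

Lemma pmult_natp p t : t%:R * p%:R \in pmult p 1.
Proof. by apply: pmultMl; [exact: pmult_nat | exact: (pmult_self p 1)]. Qed.

Lemma doubling_pow p h a : prime p -> p = (2 * h).+1 -> ~~ odd a ->
  (2 ^+ a - 1) * \sum_(1 <= k < p) k%:R ^+ a
    + a%:R * p%:R * \sum_(1 <= j < h.+1) (2 * j)%:R ^+ a.-1 \in pmult p 2.
Proof.
move=> pp pE ea.
have K := @doubling_sums p h (2 ^+ a) (fun k => k%:R ^+ a)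
  (fun k => a%:R * k%:R ^+ a.-1) pE.
case: K => [k|t j t3 jh|A B].
- by rewrite natrM exprMn.
- have lt : (2 * j <= t * p)%N by rewrite pE; nia.
  have E1 : (t * p - 2 * j)%:R ^+ a = ((2 * j)%:R + - (t%:R * p%:R)) ^+ a :> rat.
    by rewrite natrB // -opprB exprNn -signr_odd (negPf ea) expr0 mul1r (natrM _ t p).
  have tp : - (t%:R * p%:R) \in pmult p 1 by rewrite rpredN pmult_natp.
  have tp0 : - (t%:R * p%:R) \in pmult p 0 by apply: pmultW tp; rewrite prime_gt0.
  rewrite E1; apply: pmult_eq (pmult_taylor _ _ _ a (pmult_nat p _) tp _) _.
    by apply: rpredD => //; exact: pmult_nat.
  by ring.
- rewrite -mulr_sumr in A B; apply: pmult_eq (rpredB B A) _; ring.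
Qed.

Lemma doubling_powV p h m : prime p -> p = (2 * h).+1 -> ~~ odd m ->
  \sum_(1 <= k < p) k%:R ^- m - 2 * \sum_(1 <= j < h.+1) (2 * j)%:R ^- m
    - m%:R * p%:R * \sum_(1 <= j < h.+1) (2 * j)%:R ^- m.+1 \in pmult p 2 /\
  (2 ^- m - 1) * \sum_(1 <= k < p) k%:R ^- m
    - m%:R * p%:R * \sum_(1 <= j < h.+1) (2 * j)%:R ^- m.+1 \in pmult p 2.
Proof.
move=> pp pE em.
have K := @doubling_sums p h (2 ^- m) (fun k => k%:R ^- m)
  (fun k => - m%:R * k%:R ^- m.+1) pE.
case: K => [k|t j t3 jh|A B].
- by rewrite natrM exprMn invfM.
- have lt : (2 * j < t * p)%N by rewrite pE; nia.
  have E1 : (t * p - 2 * j)%:R ^- m = ((2 * j)%:R + - (t%:R * p%:R)) ^- m :> rat.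
    by rewrite natrB 1?ltnW // -opprB exprNn -signr_odd (negPf em) expr0 mul1r (natrM _ t p).
  have tp : - (t%:R * p%:R) \in pmult p 1 by rewrite rpredN pmult_natp.
  have ne : (2 * j)%:R + - (t%:R * p%:R) = - (t * p - 2 * j)%:R :> rat.
    by rewrite natrB 1?ltnW // opprB (natrM _ t p).
  have cop2j : coprime p (2 * j) by apply: coprime_small => //; lia.
  rewrite E1; apply: pmult_eq (pmult_taylorV p (2 * j)%:R _ m _ _ tp _ _) _.
  + by rewrite pnatr_eq0; lia.
  + by rewrite ne oppr_eq0 pnatr_eq0 subn_eq0 -ltnNge.
  + exact: pmult_invn.
  + rewrite ne invrN rpredN; apply: pmult_invn.
    by rewrite prime_coprime // (dvdn_subr (ltnW lt) (dvdn_mull _ (dvdnn p))) -prime_coprime.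
  + by ring.
- rewrite -mulr_sumr in A B; split.
    by apply: pmult_eq A _; ring.
  by apply: pmult_eq (rpredB B A) _; ring.
Qed.

Lemma pmult_invV p (x : rat) : x != 0 -> x^-1 \in pmult p 0 -> x - 1 \in pmult p 1 ->
  x^-1 - 1 \in pmult p 1.
Proof.
move=> x0 xp x1; have -> : x^-1 - 1 = - (x^-1 * (x - 1)) by field.
by rewrite rpredN pmultMl.
Qed.

Lemma pmult_fermatV p k : prime p -> (0 < k < p)%N ->
  k%:R ^- p.-1 - 1 \in pmult p 1.
Proof.
move=> pp kp; apply: pmult_invV; last exact: pmult_fermat.
  by rewrite expf_neq0 // pnatr_eq0 -lt0n; case/andP: kp.
by rewrite -exprVn; apply: pmultX; apply: pmult_inv_small.
Qed.

Lemma pmult_inv2 p n : prime p -> odd p -> 2 ^- n \in pmult p 0.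
Proof.
move=> pp op; rewrite -exprVn; apply: pmultX; apply: pmult_inv_small => //.
by have := prime_gt1 pp; case: p op {pp} => [|[|[|p]]].
Qed.


(** Let b be the Bernoulli number.  With S the sum of k^-m for
    1 <= k < p and E the sum of k^-(m+1) for even k, doubling_powV says that
    (2^-m - 1) S = m p E modulo p^2.  For the exponent a = p - 1 - m,
    Faulhaber's formula and doubling_pow give (2^a - 1) p b = - a p E_a, where
    E_a is the sum of k^(a-1) for even k.  Modulo
    p one has 2^a = 2^-m, a = -(m+1) and E_a = E, so that eliminating E gives
    (2^-m - 1) ((m+1) S - m p b) = 0.  The factor 2^-m - 1 is a unit since p
    does not divide 2^m - 1. *)
Lemma inv_power_sums p m : prime p -> (0 < m)%N -> ~~ odd m -> (m.+2 < p)%N ->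
  coprime p (2 ^ m - 1) ->
  m.+1%:R * \sum_(1 <= k < p) k%:R ^- m - m%:R * p%:R * bernoulli (p - m - 1)
    \in pmult p 2 /\
  \sum_(1 <= j < p./2.+1) (2 * j)%:R ^- m -
    (1 - 2 ^- m.+1) * \sum_(1 <= k < p) k%:R ^- m \in pmult p 2.
Proof.
move=> pp m0 em mp.
have op : odd p by case: (even_prime pp) => // p2; lia.
have pE : p = (2 * p./2).+1 by lia.
move: (p./2) pE => h pE.
move a_def : (p - m - 1)%N => a.
have ea : ~~ odd a by lia.
have j_lt j : (0 < j < h.+1)%N -> (0 < 2 * j < p)%N by lia.
have p2lt : (0 < 2 < p)%N by lia.
have p1a : (p.-1 = a + m)%N by lia.
have p1a' : (p.-1 = a.-1 + m.+1)%N by lia.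
have am : (a + m.+1 = p)%N by lia.
have [a1 a1p] : (1 < a /\ a.+1 < p)%N by lia.
clear op a_def; set b := bernoulli a.
have b0 : b \in pmult p 0 by exact: pmult_bernoulli.
have [A B] := doubling_powV p h m pp pE em.
have C := doubling_pow p h a pp pE ea.
have D : \sum_(1 <= k < p) k%:R ^+ a - p%:R * b \in pmult p 2.
  exact: power_sum_bernoulli.
have V : \sum_(1 <= j < h.+1) (2 * j)%:R ^+ a.-1
       - \sum_(1 <= j < h.+1) (2 * j)%:R ^- m.+1 \in pmult p 1.
  rewrite -sumrB big_nat; apply: rpred_sum => j jh.
  have j2 := j_lt j jh.
  have j0 : (2 * j)%:R != 0 :> rat by rewrite pnatr_eq0 -lt0n; case/andP: j2.
  apply: pmult_eq (pmultMl _ _ ((2 * j)%:R^-1 ^+ m.+1) _ _ (pmult_fermat p (2 * j) pp j2)) _.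
    by apply: pmultX; apply: pmult_inv_small.
  by rewrite p1a' exprD mulrBr mulr1 exprVn mulrC mulfK ?expf_neq0.
have P2 : 2 ^+ a - 2 ^- m \in pmult p 1.
  apply: pmult_eq (pmultMl _ _ (2 ^- m) _ _ (pmult_fermat p 2 pp p2lt)) _.
    by apply: pmult_inv2 => //; rewrite pE /= mul2n odd_double.
  by rewrite p1a exprD mulrBr mulr1 mulrC mulfK ?expf_neq0.
have aE : a%:R + m.+1%:R = p%:R :> rat by rewrite -natrD am.
move=> cop.
have u : (2 ^- m - 1)^-1 \in pmult p 0.
  have e0 : 2 ^+ m - 1 = (2 ^ m - 1)%N%:R :> rat by rewrite natrB ?expn_gt0 // natrX.
  have n0 : (2 ^ m - 1)%N%:R != 0 :> rat.
    by rewrite pnatr_eq0 subn_eq0 -ltnNge -{1}(expn0 2) ltn_exp2l.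
  have -> : (2 ^- m - 1)^-1 = - (2 ^+ m * (2 ^ m - 1)%N%:R^-1) :> rat.
    have t0 : 2 ^+ m != 0 :> rat by rewrite expf_neq0.
    rewrite -e0 in n0 *; move: (2 ^+ m) t0 n0 => t t0 n0.
    by field; rewrite n0 t0 mulN1r -oppr_eq0 opprB n0.
  by rewrite rpredN; apply: pmultMl; [apply: pmultX; exact: pmult_nat | exact: pmult_invn].
have u0 : 2 ^- m - 1 != 0 :> rat.
  rewrite subr_eq0 invr_eq1 -natrX (eqr_nat _ _ 1) -(expn0 2) eqn_exp2l //.
  by rewrite -lt0n.
have p1 : p%:R \in pmult p 1 by exact: (pmult_self p 1).
have pb1 : p%:R * b \in pmult p 1 by exact: pmultMr.
move: A B C D V; set S := \sum_(1 <= k < p) k%:R ^- m.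
set Dm := \sum_(1 <= j < _) (2 * j)%:R ^- m.
set E := \sum_(1 <= j < _) (2 * j)%:R ^- m.+1.
set Sa := \sum_(1 <= k < p) k%:R ^+ a.
set Ea := \sum_(1 <= j < _) (2 * j)%:R ^+ a.-1 => A B C D V.
have E0 : E \in pmult p 0.
  rewrite /E big_nat; apply: rpred_sum => j jh.
  by rewrite -exprVn; apply: pmultX; apply: pmult_inv_small => //; exact: j_lt.
have p2 : p%:R * p%:R \in pmult p 2 by exact: (pmultM p 1 1).
split.
  have key : (2 ^- m - 1) * (m.+1%:R * S - m%:R * p%:R * b) \in pmult p 2.
    have mI : m%:R \in pmult p 0 by exact: pmult_nat.
    have h1 : m.+1%:R * ((2 ^- m - 1) * S - m%:R * p%:R * E) \in pmult p 2.
      exact: (pmultMl _ _ _ _ (pmult_nat p m.+1) B).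
    have h2 : m%:R * ((2 ^+ a - 1) * Sa + a%:R * p%:R * Ea) \in pmult p 2.
      exact: (pmultMl _ _ _ _ mI C).
    have h3 : m%:R * ((2 ^+ a - 1) * (Sa - p%:R * b)) \in pmult p 2.
      apply: (pmultMl _ _ _ _ mI); apply: (pmultMl _ _ _ _ _ D).
      by rewrite rpredB ?pmult1 // pmultX ?pmult_nat.
    have h4 : m%:R * (a%:R * (p%:R * (Ea - E))) \in pmult p 2.
      apply: (pmultMl _ _ _ _ mI); apply: (pmultMl _ _ _ _ (pmult_nat p a)).
      exact: (pmultM p 1 1).
    have h5 : m%:R * (E * (p%:R * p%:R)) \in pmult p 2.
      by apply: (pmultMl _ _ _ _ mI); apply: (pmultMl _ _ _ _ E0).
    have h6 : m%:R * ((2 ^+ a - 2 ^- m) * (p%:R * b)) \in pmult p 2.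
      by apply: (pmultMl _ _ _ _ mI); exact: (pmultM p 1 1).
    apply: pmult_eq (rpredB (rpredD (rpredD (rpredD (rpredD h1 h3) h4) h5) h6) h2) _.
    have -> : a%:R = p%:R - m.+1%:R :> rat by rewrite -aE addrK.
    ring.
  by apply: pmult_eq (pmultMl _ _ _ _ u key) _; rewrite mulKf.
have i2 : 2^-1 \in pmult p 0 by apply: (pmult_inv2 p 1) => //; rewrite pE /= mul2n odd_double.
apply: pmult_eq (pmultMl _ _ _ _ i2 (rpredB B A)) _.
rewrite exprS; field; rewrite ?expf_neq0 //.
Qed.

(** * The binomial tail modulo p^2 *)

Definition harmonic (k : nat) : rat := \sum_(1 <= j < k.+1) j%:R^-1.

Lemma harmonic_int p k : prime p -> (k < p)%N -> harmonic k \in pmult p 0.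
Proof.
move=> pp kp; rewrite /harmonic big_nat; apply: rpred_sum => j jk.
by apply: pmult_inv_small => //; lia.
Qed.

Lemma harmonicS k : harmonic k.+1 = harmonic k + k.+1%:R^-1.
Proof. by rewrite /harmonic big_nat_recr. Qed.

(** The ratio of consecutive signed terms is 1 - p/(k+1). *)
Lemma binomial_pred_mod p k : prime p -> (k < p)%N ->
  (-1) ^+ k * 'C(p.-1, k)%:R - 1 + p%:R * harmonic k \in pmult p 2.
Proof.
move=> pp; elim: k => [|k IH] kp.
  by rewrite bin0 mulr1 subrr add0r /harmonic big_geq // mulr0 rpred0.
have k0 : k.+1%:R != 0 :> rat by rewrite pnatr_eq0.
have C : k.+1%:R * 'C(p.-1, k.+1)%:R = (p%:R - k.+1%:R) * 'C(p.-1, k)%:R :> rat.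
  rewrite -natrM mul_bin_left natrM -natrB; last exact: ltnW.
  by have -> : (p - k.+1 = p.-1 - k)%N by lia.
have {}C : 'C(p.-1, k.+1)%:R = k.+1%:R^-1 * ((p%:R - k.+1%:R) * 'C(p.-1, k)%:R) :> rat.
  by rewrite -C mulKf.
have i0 : k.+1%:R^-1 \in pmult p 0 by apply: pmult_inv_small.
have h1 : (1 - p%:R * k.+1%:R^-1) * ((-1) ^+ k * 'C(p.-1, k)%:R - 1 + p%:R * harmonic k)
   \in pmult p 2.
  apply: pmultMl; last by apply: IH; exact: ltnW.
  by rewrite rpredB ?pmult1 // pmultMl ?pmult_nat.
have h2 : p%:R * p%:R * (harmonic k * k.+1%:R^-1) \in pmult p 2.
  apply: pmultMr; first exact: (pmult_self p 2).
  by apply: pmultMl => //; apply: harmonic_int => //; exact: ltnW.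
apply: pmult_eq (rpredD h1 h2) _; rewrite C harmonicS exprS.
by move: k.+1%:R k0 => c c0; field.
Qed.

(** Inverting is raising to the power p - 2 modulo p. *)
Lemma harmonic_faulhaber p k : prime p -> (k < p)%N ->
  harmonic k - faulhaber (p - 2) k%:R \in pmult p 1.
Proof.
move=> pp kp; rewrite -faulhaber_sum /harmonic -sumrB big_nat.
apply: rpred_sum => j jk; have jp : (0 < j < p)%N by lia.
apply: pmult_eq (pmultMl _ _ (- j%:R^-1) _ _ (pmult_fermat p j pp jp)) _.
  by rewrite rpredN pmult_inv_small.
have -> : (p.-1 = (p - 2).+1)%N by have := prime_gt1 pp; lia.
have j0 : j%:R != 0 :> rat by rewrite pnatr_eq0; lia.
by rewrite exprS; field.
Qed.

(** This is faulhaber n ((x - 1) / 2) up to an additive constant: n-th powers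
    summed over even, over odd and over all numbers are related by
    Phi(x/2) + Phi((x-1)/2) = 2^-n Phi(x) + const.  In this form the
    coefficients are visible without expanding powers of x - 1. *)
Definition half_faulhaber (n : nat) (x : rat) : rat :=
  2 ^- n * faulhaber n x - faulhaber n (x / 2).

(** Both sides change equally from k to k + 1, because
    Phi(k/2 + 1) - Phi(k/2) = 2^-n (k + 2)^n. *)
Lemma half_faulhaber_sum n k :
  half_faulhaber n k%:R + half_faulhaber n k.+1%:R =
  2 ^- n * faulhaber n k%:R + half_faulhaber n 1.
Proof.
elim: k => [|k IH].
  by rewrite /half_faulhaber mul0r faulhaber0; ring.
have -> : half_faulhaber n k.+2%:R =
    half_faulhaber n k%:R + 2 ^- n * (faulhaber n k.+1%:R - faulhaber n k%:R).
  rewrite /half_faulhaber; have -> : k.+2%:R / 2 = k%:R / 2 + 1 :> rat.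
    by rewrite -addn2 natrD; field.
  rewrite -(natr1 k.+1) -(natr1 k) !faulhaberS.
  have -> : k%:R / 2 + 1 = (k%:R + 1 + 1) / 2 :> rat by field.
  by rewrite exprMn exprVn; ring.
by rewrite addrA (addrC (half_faulhaber n k.+1%:R)) IH; ring.
Qed.

Lemma faulhaber_int p n (x : rat) : prime p -> (n.+1 < p)%N -> x \in pmult p 0 ->
  faulhaber n x \in pmult p 0.
Proof.
move=> pp np xp; rewrite /faulhaber mulrC; apply: pmultMl.
  by apply: pmult_inv_small => //; lia.
apply: rpred_sum => i _; apply: pmultMl; last exact: pmultX.
apply: pmultMl; first exact: pmult_nat.
by apply: pmult_bernoulli => //; have := ltn_ord i; lia.
Qed.

Lemma half_faulhaber_int p n (x : rat) : prime p -> odd p -> (n.+1 < p)%N ->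
  x \in pmult p 0 -> half_faulhaber n x \in pmult p 0.
Proof.
move=> pp op np xp; have i2 : 2^-1 \in pmult p 0 by apply: (pmult_inv2 p 1).
rewrite /half_faulhaber rpredB ?faulhaber_int //; last exact: pmultMl.
by apply: pmultMl; [exact: pmult_inv2 | exact: faulhaber_int].
Qed.

(** By power_sum_ratio the sum is minus the coefficient of x^m in
    half_faulhaber (p - 2), which is
    C(p-1, p-1-m) B_(p-1-m) / (p-1) * (2^-(p-2) - 2^-m); modulo p the binomial
    coefficient is 1, p - 1 is -1 and 2^-(p-2) is 2. *)
Lemma sum_half_faulhaber p m : prime p -> (0 < m)%N -> ~~ odd m -> (m.+2 < p)%N ->
  \sum_(1 <= k < p) half_faulhaber (p - 2) k%:R / k%:R ^+ m
    - (2 - 2 ^- m) * bernoulli (p - m - 1) \in pmult p 1.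
Proof.
move=> pp m0 em mp.
have op : odd p by case: (even_prime pp) => // p2; lia.
set n := (p - 2)%N; have nE : (p = n.+2)%N by rewrite /n; lia.
have q_lt : (0 < p.-1 < p)%N by lia.
have n1 : n.+1%:R = p.-1%:R :> rat by rewrite nE.
pose c (i : nat) : rat := 'C(n.+1, i)%:R * bernoulli i / n.+1%:R * (2 ^- n - 2 ^- (n.+1 - i)).
have c0 (i : 'I_n.+1) : c i \in pmult p 0.
  apply: pmultMl; last by rewrite rpredB // pmult_inv2.
  apply: pmultMr; last by apply: pmult_inv_small => //; lia.
  apply: pmultMl; first exact: pmult_nat.
  by apply: pmult_bernoulli => //; have := ltn_ord i; lia.
have FE (x : rat) : half_faulhaber n x = \sum_(i < n.+1) c i * x ^+ (n.+1 - i).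
  rewrite /half_faulhaber /faulhaber !mulr_suml mulr_sumr -sumrB.
  apply: eq_bigr => i _; rewrite /c exprMn exprVn.
  by ring.
have a_lt : (p - m - 1 < n.+1)%N by lia.
have -> : \sum_(1 <= k < p) half_faulhaber n k%:R / k%:R ^+ m =
   \sum_(i < n.+1) c i * \sum_(1 <= k < p) (k%:R ^+ (n.+1 - i) / k%:R ^+ m).
  under [RHS]eq_bigr => i _ do rewrite mulr_sumr.
  rewrite [RHS]exchange_big /=; apply: eq_bigr => k _.
  by rewrite FE mulr_suml; apply: eq_bigr => i _; rewrite mulrA.
have h1 : \sum_(i < n.+1) c i * (\sum_(1 <= k < p) (k%:R ^+ (n.+1 - i) / k%:R ^+ m)
    + ((n.+1 - i)%N == m)%:R) \in pmult p 1.
  apply: rpred_sum => i _; apply: pmultMl => //.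
  by apply: power_sum_ratio => //; lia.
have h2 : c (p - m - 1)%N + (2 - 2 ^- m) * bernoulli (p - m - 1) \in pmult p 1.
  set a := (p - m - 1)%N; have ea : ~~ odd a by rewrite /a; lia.
  have b0 : bernoulli a \in pmult p 0 by apply: pmult_bernoulli => //; rewrite /a; lia.
  have am : (n.+1 - a = m)%N by rewrite /a; lia.
  have B : 'C(p.-1, a)%:R - 1 \in pmult p 1.
    have ap : (a < p)%N by rewrite /a; lia.
    have := binomial_pred_mod p a pp ap; rewrite -signr_odd (negPf ea) expr0 mul1r => H.
    have H1 : p%:R * harmonic a \in pmult p 1.
      by apply: pmultMr; [exact: (pmult_self p 1) | exact: harmonic_int].
    by apply: pmult_eq (rpredB (pmultW _ _ _ (prime_gt0 pp) H) H1) _; rewrite addrK.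
  have p2 : (0 < 2 < p)%N by lia.
  have D : 2 ^- n - 2 \in pmult p 1.
    apply: pmult_eq (pmultMl _ _ 2 _ (pmult_nat p 2) (pmult_fermatV p 2 pp p2)) _.
    have -> : (p.-1 = n.+1)%N by lia.
    have t0 : 2 ^+ n != 0 :> rat by rewrite expf_neq0.
    by rewrite exprS; field.
  have P : p%:R \in pmult p 1 by exact: (pmult_self p 1).
  have I : p.-1%:R^-1 \in pmult p 0 by exact: pmult_inv_small.
  have pn0 : p.-1%:R != 0 :> rat by rewrite pnatr_eq0 -lt0n; case/andP: q_lt.
  have pE : p%:R = p.-1%:R + 1 :> rat by rewrite natr1 prednK ?prime_gt0.
  have i2 k : 2 ^- k \in pmult p 0 by exact: pmult_inv2.
  have g1 : ('C(p.-1, a)%:R - 1) * (bernoulli a / p.-1%:R * (2 ^- n - 2 ^- m)) \in pmult p 1.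
    apply: pmultMr; first exact: B.
    by apply: pmultMl; [exact: pmultMl | exact: rpredB].
  have g2 : (2 ^- n - 2) * (bernoulli a / p.-1%:R) \in pmult p 1.
    by apply: pmultMr => //; apply: pmultMl.
  have g3 : p%:R * (bernoulli a / p.-1%:R * (2 - 2 ^- m)) \in pmult p 1.
    apply: pmultMr => //; apply: pmultMl; first exact: pmultMl.
    by rewrite rpredB // pmult_nat.
  apply: pmult_eq (rpredD (rpredD g1 g2) g3) _.
  rewrite /c am n1 -[n.+1]/(n.+2.-1) -nE pE.
  by move: (2 ^- n) (2 ^- m) p.-1%:R pn0 => u v q q0; field.
rewrite (_ : \sum_(i < _) _ * \sum_(1 <= k < p) _ = 
   \sum_(i < n.+1) c i * (\sum_(1 <= k < p) (k%:R ^+ (n.+1 - i) / k%:R ^+ m)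
    + ((n.+1 - i)%N == m)%:R) - c (p - m - 1)%N); last first.
  under [in RHS]eq_bigr => i _ do rewrite mulrDr.
  rewrite big_split /= [X in _ + X - _](bigD1 (Ordinal a_lt)) //=.
  rewrite [X in _ + (_ + X) - _]big1 => [|i]; last first.
    rewrite -val_eqE /= => ia; have -> : ((n.+1 - i)%N == m) = false by have := ltn_ord i; lia.
    by rewrite mulr0.
  have -> : ((n.+1 - (p - m - 1))%N == m) = true by lia.
  by rewrite mulr1 addr0 addrK.
by apply: pmult_eq (rpredB h1 h2) _; ring.
Qed.

Definition binomial_tail (p k : nat) : rat := \sum_(k <= j < p) 'C(p.-1, j)%:R.

(** The signed tails Q_k satisfy Q_k + Q_(k+1) = (-1)^k C(p-1,k).  Subtracting
    the particular solution given by half_faulhaber leaves a sequence that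
    changes sign at each step modulo p^2, hence (-1)^k g.  The vanishing of Q_p
    determines g modulo p, as p is odd. *)
Lemma signed_tail_mod p : prime p -> odd p -> exists g al : rat,
  [/\ al \in pmult p 0, g - 2^-1 \in pmult p 1 &
   forall k, (k <= p)%N ->
   (-1) ^+ k * binomial_tail p k - 2^-1
     + p%:R * (2^-1 * half_faulhaber (p - 2) k%:R + al) - (-1) ^+ k * g \in pmult p 2].
Proof.
move=> pp op; have p0 := prime_gt0 pp.
set n := (p - 2)%N; have np : (n.+1 < p)%N by rewrite /n; have := prime_gt1 pp; lia.
have pE : (p.-1 = n.+1)%N by rewrite /n; lia.
have p2 : (0 < 2 < p)%N by have := prime_gt1 pp; lia.
have i2 : 2^-1 \in pmult p 0 by apply: (pmult_inv2 p 1).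
have F0 k : half_faulhaber n k%:R \in pmult p 0.
  by apply: half_faulhaber_int => //; exact: pmult_nat.
(* This choice makes 2 al cancel half of the constant half_faulhaber n 1 in
   half_faulhaber_sum. *)
pose al := - (2^-1 * (2^-1 * half_faulhaber n 1)).
have al0 : al \in pmult p 0.
  by rewrite rpredN; do 2!apply: pmultMl => //; exact: (F0 1%N).
pose d k := (-1) ^+ k * binomial_tail p k - 2^-1 + p%:R * (2^-1 * half_faulhaber n k%:R + al).
have P1 : p%:R \in pmult p 1 by exact: (pmult_self p 1).
have dS k : (k < p)%N -> d k + d k.+1 \in pmult p 2.
  move=> kp.
  have h1 := binomial_pred_mod p k pp kp.
  have h2 : p%:R * (harmonic k - faulhaber n k%:R) \in pmult p 2.
    by apply: (pmultM p 1 1) => //; exact: harmonic_faulhaber.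
  have h3 : p%:R * ((2 ^- p.-1 - 1) * faulhaber n k%:R) \in pmult p 2.
    apply: (pmultM p 1 1) => //; apply: pmultMr; first exact: pmult_fermatV.
    by apply: faulhaber_int => //; exact: pmult_nat.
  apply: pmult_eq (rpredD (rpredB h1 h2) h3) _.
  have HF := half_faulhaber_sum n k.
  have {}HF : half_faulhaber n k.+1%:R =
      2 ^- n * faulhaber n k%:R + half_faulhaber n 1 - half_faulhaber n k%:R.
    by rewrite -HF; ring.
  have T : binomial_tail p k = 'C(p.-1, k)%:R + binomial_tail p k.+1.
    by rewrite /binomial_tail big_ltn.
  rewrite /d HF T /al pE !exprS.
  move: (2 ^+ n) (expf_neq0 n (isT : (2 : rat) != 0)) => t t0.
  by field.
have dk k : (k <= p)%N -> d k - (-1) ^+ k * d 0%N \in pmult p 2.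
  elim: k => [|k IH] kp; first by rewrite mul1r subrr rpred0.
  apply: pmult_eq (rpredB (dS k kp) (IH (ltnW kp))) _.
  by rewrite exprS; ring.
exists (d 0%N), al; split=> //.
(* The tail is empty at k = p, which gives - 1/2 + g = 0 modulo p. *)
have := dk p (leqnn p); rewrite -signr_odd op expr1 => /(pmultW _ _ _ p0) h.
have h' : p%:R * (2^-1 * half_faulhaber n p%:R + al) \in pmult p 1.
  by apply: pmultMr => //; rewrite rpredD // pmultMl.
apply: pmult_eq (rpredB h h') _.
by rewrite /d [in binomial_tail p p]/binomial_tail big_geq //; ring.
Qed.

Lemma alternating_inv_power_sum p m : prime p -> odd p -> ~~ odd m ->
  \sum_(1 <= k < p) (-1) ^+ k / k%:R ^+ m =
  2 * \sum_(1 <= j < p./2.+1) (2 * j)%:R ^- m - \sum_(1 <= k < p) k%:R ^- m :> rat.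
Proof.
move=> pp op em; have pE : p = (2 * p./2).+1 by lia.
move: (p./2) pE => h pE; rewrite [in LHS]pE.
rewrite [X in _ - X](_ : _ = \sum_(1 <= k < (2 * h).+1) k%:R ^- m); last first.
  by rewrite -pE.
rewrite !sum_parity_split -!pE.
rewrite (eq_big_nat _ _ (F2 := fun j => (2 * j)%:R ^- m)) => [|j _]; last first.
  by rewrite exprM sqrrN !expr1n mul1r.
rewrite [X in _ + X = _](eq_big_nat _ _ (F2 := fun j => - (p - 2 * j)%:R ^- m)) => [|j jh]; last first.
  rewrite -signr_odd oddB; last by lia.
  by rewrite op mul2n odd_double mulN1r.
by rewrite sumrN; ring.
Qed.

(** Sum signed_tail_mod against k^-m and insert the values of the three sums.
    The constant al meets p S and the error g - 1/2 meets the alternating sum,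
    so both contributions are multiples of p^2. *)
Lemma signed_tail_sum p m : prime p -> (0 < m)%N -> ~~ odd m -> (m.+2 < p)%N ->
  coprime p (2 ^ m - 1) ->
  \sum_(1 <= k < p) (-1) ^+ k * binomial_tail p k / k%:R ^+ m
    + (1 - 2 ^- m.+1) * (bernoulli (p - m - 1) / m.+1%:R) * p%:R \in pmult p 2.
Proof.
move=> pp m0 em mp cop.
have op : odd p by case: (even_prime pp) => // p2; move: mp; rewrite p2.
have [SE DE] := inv_power_sums p m pp m0 em mp cop.
have FE := sum_half_faulhaber p m pp m0 em mp.
have TE := alternating_inv_power_sum p m pp op em.
have [g [al [al0 g1 tE]]] := signed_tail_mod p pp op.
have P1 : p%:R \in pmult p 1 by exact: (pmult_self p 1).
have i2 k : 2 ^- k \in pmult p 0 by exact: pmult_inv2.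
have mlt : (0 < m.+1 < p)%N by rewrite /=; exact: ltnW.
have im : m.+1%:R^-1 \in pmult p 0 by exact: pmult_inv_small.
have b0 : bernoulli (p - m - 1) \in pmult p 0.
  by apply: pmult_bernoulli => //; clear -m0 mp; lia.
have K0 : 1 - 2 ^- m.+1 \in pmult p 0 by rewrite rpredB ?pmult1.
have S1 : \sum_(1 <= k < p) k%:R ^- m \in pmult p 1.
  have h : m.+1%:R^-1 * (m.+1%:R * \sum_(1 <= k < p) k%:R ^- m 
      - m%:R * p%:R * bernoulli (p - m - 1)) \in pmult p 1.
    by apply: (pmultMl _ _ _ _ im); apply: pmultW SE; exact: prime_gt0.
  have h' : m.+1%:R^-1 * (m%:R * (p%:R * bernoulli (p - m - 1))) \in pmult p 1.
    by apply: (pmultMl _ _ _ _ im); apply: (pmultMl _ _ _ _ (pmult_nat p m)); exact: pmultMr.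
  apply: pmult_eq (rpredD h h') _.
  have : m.+1%:R != 0 :> rat by rewrite pnatr_eq0.
  by move: m.+1%:R => c c0; field.
move: SE DE FE TE b0 S1; set S := \sum_(1 <= k < p) k%:R ^- m.
set D := \sum_(1 <= j < _) _; set T := \sum_(1 <= k < p) (-1) ^+ k / _.
set F := \sum_(1 <= k < p) _; set b := bernoulli _ => SE DE FE TE b0 S1.
have D1 : D \in pmult p 1.
  have h : (1 - 2 ^- m.+1) * S \in pmult p 1 by exact: pmultMl.
  by apply: pmult_eq (rpredD (pmultW _ _ _ (prime_gt0 pp) DE) h) _; rewrite subrK.
have T1 : T \in pmult p 1.
  by rewrite TE rpredB // pmultMl ?pmult_nat.
have sumE : \sum_(1 <= k < p) (-1) ^+ k * binomial_tail p k / k%:R ^+ m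
    - (2^-1 * S - p%:R * (2^-1 * F + al * S) + g * T) \in pmult p 2.
  rewrite /S /F /T !mulr_sumr -big_split /= mulr_sumr -sumrB -big_split /= -sumrB big_nat.
  apply: rpred_sum => k /andP[k0 kp].
  have ik : k%:R ^- m \in pmult p 0.
    by rewrite -exprVn; apply: pmultX; apply: pmult_inv_small => //; rewrite k0.
  apply: pmult_eq (pmultMr _ _ _ _ (tE k (ltnW kp)) ik) _.
  by ring.
have e1 : (g - 2^-1) * T \in pmult p 2 by exact: (pmultM p 1 1).
have e2 : al * (p%:R * S) \in pmult p 2 by apply: pmultMl => //; exact: (pmultM p 1 1).
have e3 : 2^-1 * (p%:R * (F - (2 - 2 ^- m) * b)) \in pmult p 2.
  by apply: pmultMl; [exact: (i2 1%N) | exact: (pmultM p 1 1)].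
have e4 : (1 - 2 ^- m.+1) * m.+1%:R^-1 * (m.+1%:R * S - m%:R * p%:R * b) \in pmult p 2.
  by apply: pmultMl => //; exact: pmultMl.
apply: pmult_eq (rpredD (rpredD (rpredB (rpredB (rpredD sumE e1) e2) e3) DE) e4) _.
rewrite TE exprS -(natr1 m).
have : m%:R + 1 != 0 :> rat by rewrite natr1 pnatr_eq0.
move: (2 ^+ m) (expf_neq0 m (isT : (2 : rat) != 0)) => t t0 c0.
by field; rewrite t0 c0.
Qed.

(** * The exact formula for the truncated value at 1/2 *)

Fixpoint star_harmonic (r n : nat) : rat :=
  if r is r'.+1 then \sum_(1 <= i < n.+1) star_harmonic r' i / i%:R else 1.

(** Induction on r, then on n: the increments of the right-hand side agree
    with star_harmonic r n / n because
    (C(n+1,k) - C(n,k)) / k = C(n,k-1) / k = C(n+1,k) / (n+1).  The case r = 0 is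
    the alternating sum of a row of binomial coefficients. *)
Lemma star_harmonic_binomial r n : (0 < n)%N ->
  star_harmonic r n = - \sum_(1 <= k < n.+1) (-1) ^+ k * 'C(n, k)%:R / k%:R ^+ r.
Proof.
elim: r n => [|r IH] n n0.
  have := exprDn (1 : rat) (-1) n; rewrite subrr expr0n -(prednK n0) /=.
  rewrite (prednK n0) -(big_mkord xpredT (fun i => 1 ^+ (n - i) * (-1) ^+ i *+ 'C(n, i))).
  rewrite big_ltn // expr0 bin0 expr1n mulr1 => /eqP; rewrite eq_sym addr_eq0.
  move=> /eqP H; apply: etrans H _.
  congr (- _); apply: eq_bigr => k _.
  by rewrite expr0 divr1 expr1n mul1r mulr_natr.
elim: n {n0} => [|n IHn]; first by rewrite /= !big_geq // oppr0.
have -> : star_harmonic r.+1 n.+1 =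
    star_harmonic r.+1 n + star_harmonic r n.+1 / n.+1%:R.
  by rewrite /= big_nat_recr.
have E : \sum_(1 <= k < n.+1) (-1) ^+ k * 'C(n, k)%:R / k%:R ^+ r.+1 =
         \sum_(1 <= k < n.+2) (-1) ^+ k * 'C(n, k)%:R / k%:R ^+ r.+1 :> rat.
  by rewrite [RHS]big_nat_recr //= bin_small // mulr0 mul0r addr0.
rewrite IHn E IH // mulNr -opprD mulr_suml -big_split /=; congr (- _).
apply: eq_big_nat => [[//|k] _]; rewrite (exprS _ r).
have k0' : k.+1%:R != 0 :> rat by rewrite pnatr_eq0.
have n0' : n.+1%:R != 0 :> rat by rewrite pnatr_eq0.
have B : 'C(n, k.+1)%:R =
    'C(n.+1, k.+1)%:R - k.+1%:R * 'C(n.+1, k.+1)%:R / n.+1%:R :> rat.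
  have -> : k.+1%:R * 'C(n.+1, k.+1)%:R = n.+1%:R * 'C(n, k)%:R :> rat.
    by rewrite -!natrM -mul_bin_diag.
  by rewrite (mulrC n.+1%:R) mulfK // binS natrD addrK.
rewrite B; move: n.+1%:R n0' k.+1%:R k0' => c c0 e e0.
by field; rewrite expf_neq0 // e0 c0.
Qed.

Lemma binomial_tailS N k : binomial_tail N.+2 k.+1 =
  2 * binomial_tail N.+1 k.+1 + 'C(N, k)%:R * (k <= N)%N%:R.
Proof.
rewrite /binomial_tail /= big_add1 /=.
under eq_bigr => j _ do rewrite binS natrD.
rewrite big_split /=.
case: leqP => kN; last by rewrite !big_geq ?mulr0 ?addr0 //; lia.
rewrite mulr1 [X in _ + X = _]big_ltn // -(big_add1 _ _ k N.+2 xpredT (fun j => 'C(N, j)%:R)) /=.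
rewrite [X in X + _ = _]big_nat_recr //= bin_small // addr0.
by ring.
Qed.

(** The depth is m + 1: the largest index n is kept apart from the m others. *)
Definition star_half (m p : nat) : rat :=
  \sum_(1 <= n < p) star_harmonic m n / (n%:R * 2 ^+ n).

(** Induction on N: one more term of the sum is, by star_harmonic_binomial, the
    combination of the 2^-(N+1) C(N,k-1) / k^(m+1) by which the scaled tails
    change according to Pascal's rule (binomial_tailS). *)
Lemma star_half_tail m N :
  star_half m N.+1 =
  - 2 ^- N * \sum_(1 <= k < N.+1) (-1) ^+ k * binomial_tail N.+1 k / k%:R ^+ m.+1.
Proof.
rewrite /star_half; elim: N => [|N IH]; first by rewrite !big_geq // mulr0.
rewrite big_nat_recr //= IH star_harmonic_binomial //.
have -> : \sum_(1 <= k < N.+1) (-1) ^+ k * binomial_tail N.+1 k / k%:R ^+ m.+1 =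
          \sum_(1 <= k < N.+2) (-1) ^+ k * binomial_tail N.+1 k / k%:R ^+ m.+1.
  rewrite [RHS]big_nat_recr //= [in RHS]/binomial_tail (@big_geq _ _ _ N.+1 N.+1) //.
  by rewrite mulr0 mul0r addr0.
rewrite !mulr_sumr mulNr mulr_suml -sumrN -big_split /=.
apply: eq_big_nat => [[//|k] /andP[_ kN]].
have k0' : k.+1%:R != 0 :> rat by rewrite pnatr_eq0.
have n0' : N.+1%:R != 0 :> rat by rewrite pnatr_eq0.
have t0 : 2 ^+ N != 0 :> rat by rewrite expf_neq0.
have B : 'C(N.+1, k.+1)%:R = N.+1%:R * 'C(N, k)%:R / k.+1%:R :> rat.
  by rewrite -natrM -[N in ('C(N, k))]/(N.+1.-1) mul_bin_diag natrM mulrC mulKf.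
have {}kN : (k <= N)%N by [].
rewrite binomial_tailS kN mulr1 B (exprS _ m) (exprS _ N).
move: (2 ^+ N) t0 N.+1%:R n0' k.+1%:R k0' => t t0 c c0 e e0.
by field; rewrite expf_neq0 // e0 c0 t0.
Qed.

(** * From tuples to nested sums, and from rationals to A2 *)

Lemma big_tuple_cons (T : finType) r (P : pred (r.+1.-tuple T))
    (F : r.+1.-tuple T -> rat) :
  \sum_(t | P t) F t =
  \sum_(x : T) \sum_(t : r.-tuple T | P [tuple of x :: t]) F [tuple of x :: t].
Proof.
rewrite pair_big_dep /=.
rewrite (reindex (fun u : T * r.-tuple T => [tuple of u.1 :: u.2])) //=.
exists (fun t => (thead t, [tuple of behead t])) => [[x t] _|t _] /=.
  by congr pair; apply: val_inj.
by rewrite -tuple_eta.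
Qed.

(** Peel off the largest index, which is the head of the tuple. *)
Lemma star_harmonic_tuple p r n : (n < p)%N ->
  \sum_(t : r.-tuple 'I_p | path geq n [seq val i | i <- t]
      && all (fun i : 'I_p => 0 < i)%N t) (\prod_(i <- t) (val i)%:R)^-1
  = star_harmonic r n :> rat.
Proof.
elim: r n => [|r IH] n np.
  rewrite (bigD1 [tuple]) //= big_nil invr1 big1 ?addr0 // => t /andP[_].
  by move=> /eqP[]; exact: tuple0.
rewrite big_tuple_cons /= (@big_nat_widenl _ _ _ 1 0) // (@big_nat_widen _ _ _ 0 _ p) //.
rewrite big_mkord [RHS]big_mkcond; apply: eq_bigr => x _ /=.
case: ifPn => [/andP[x0 xn]|xn].
  rewrite -(IH x) // mulr_suml; apply: eq_big => t; first by rewrite x0 -ltnS xn.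
  by move=> _; rewrite big_cons invfM mulrC.
apply: big1 => t /andP[/andP[nx _] /andP[x0 _]].
by rewrite x0 ltnS nx in xn.
Qed.

Lemma polylog_star_half_truncE m p :
  polylog_star_half_trunc m.+1 p = star_half m p.
Proof.
rewrite /polylog_star_half_trunc /star_half big_tuple_cons /=.
rewrite (@big_nat_widenl _ _ _ 1 0) // big_mkord [RHS]big_mkcond.
apply: eq_bigr => x _ /=; case: ifPn => [x0|x0].
  rewrite -(star_harmonic_tuple p m x) // mulr_suml.
  apply: eq_big => // t.
  by move=> _; rewrite big_cons div1r !invfM mulrCA mulrA.
by apply: big1 => t /andP[].
Qed.

Lemma pmult_int_dvd p e (a : int) : prime p -> a%:~R \in pmult p e -> (p ^ e %| `|a|)%N.
Proof.
move=> pp /pmultP[u [v [pv E]]].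
have v0 : (v != 0)%N.
  apply: contraL pv => /eqP ->.
  by rewrite /coprime gcdn0 neq_ltn prime_gt1 // orbT.
have p0 : p%:R ^+ e != 0 :> rat by rewrite expf_neq0 // pnatr_eq0 -lt0n prime_gt0.
have : a * v%:Z = u * (p ^ e)%N%:Z.
  apply/eqP; rewrite -(eqr_int rat) !intrM -!pmulrn natrX.
  have v0' : v%:R != 0 :> rat by rewrite pnatr_eq0.
  by rewrite -{1}[a%:~R](divfK p0) E; apply/eqP; field.
move/(congr1 absz); rewrite !abszM /= => H.
have : (p ^ e %| `|a| * v)%N by rewrite H dvdn_mull.
by rewrite Gauss_dvdl // coprimeXl.
Qed.

(** Both denominators are units modulo p^2, and the cross difference of the
    numerators is an integer multiple of p^2. *)
Lemma ratr_Zp2_eq p (x y : rat) : prime p -> x \in pmult p 0 -> y \in pmult p 0 ->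
  x - y \in pmult p 2 -> ratr x = ratr y :> 'Z_((p ^ 2)%N).
Proof.
move=> pp xp yp xyp.
have p2 : (1 < p ^ 2)%N by rewrite (ltn_exp2l 0) ?prime_gt1.
have dU z : z \in pmult p 0 -> ((denq z)%:~R : 'Z_((p ^ 2)%N)) \is a GRing.unit.
  rewrite unfold_in /pmult divr1 => cz.
  rewrite -absz_denq -pmulrn unitZpE // coprimeXl //.
pose N : int := numq x * denq y - numq y * denq x.
have dvd : (p ^ 2 %| `|N|)%N.
  apply: pmult_int_dvd => //.
  have -> : N%:~R = (x - y) * ((denq x)%:~R * (denq y)%:~R) :> rat.
    have dx : (denq x)%:~R != 0 :> rat by rewrite intr_eq0 denq_neq0.
    have dy : (denq y)%:~R != 0 :> rat by rewrite intr_eq0 denq_neq0.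
    by rewrite /N -{3}[x]divq_num_den -{3}[y]divq_num_den rmorphB !rmorphM /=; field; rewrite dx dy.
  by apply: pmultMr => //; apply: pmultMl; exact: pmult_int.
have /eqP : (N%:~R : 'Z_((p ^ 2)%N)) = 0.
  case/dvdnP: dvd => q E.
  rewrite [N]intEsign E PoszM !intrM -!pmulrn.
  by rewrite pchar_Zp // !mulr0.
rewrite /N rmorphB !rmorphM /= subr_eq0 => /eqP H.
apply: (mulIr (dU y yp)); apply: (mulIr (dU x xp)).
by rewrite /ratr mulrAC !divrK ?dU // H.
Qed.

(** The bound on p makes p odd, larger than m + 2 and prime to 2^m - 1. *)
Lemma polylog_star_half_congr p m : prime p -> (0 < m)%N -> ~~ odd m ->
  (2 ^ m + m.+2 < p)%N ->
  let X := (2 ^+ m.+1 - 1) / 2 ^+ m.+1 * (bernoulli (p - m - 1) / m.+1%:R) * p%:R in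
  X \in pmult p 1 /\ polylog_star_half_trunc m p - X \in pmult p 2.
Proof.
move=> pp m0 em mp X.
have mp' : (m.+2 < p)%N by apply: leq_ltn_trans mp; rewrite leq_addl.
have op : odd p by case: (even_prime pp) => // p2; move: mp'; rewrite p2.
have cop : coprime p (2 ^ m - 1).
  apply: coprime_small => //; rewrite subn_gt0 -{1}(expn0 2) ltn_exp2l // m0 /=.
  apply: leq_ltn_trans (leq_subr _ _) _; apply: leq_ltn_trans mp; exact: leq_addr.
have XE : X = (1 - 2 ^- m.+1) * (bernoulli (p - m - 1) / m.+1%:R) * p%:R.
  by rewrite /X mulrBl divff ?expf_neq0 // div1r.
have i2 k : 2 ^- k \in pmult p 0 by exact: pmult_inv2.
have X1 : X \in pmult p 1.
  rewrite XE; apply: pmultMl; last exact: (pmult_self p 1).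
  apply: pmultMl; first by rewrite rpredB ?pmult1.
  apply: pmultMl; last by apply: pmult_inv_small => //; exact: ltnW.
  by apply: pmult_bernoulli => //; clear -m0 mp'; lia.
split=> //; rewrite -(prednK m0) polylog_star_half_truncE.
have := signed_tail_sum p m pp m0 em mp' cop; rewrite -XE.
rewrite -{1 2}(prednK (prime_gt0 pp)) -{1}(prednK m0) => H.
rewrite -{1}(prednK (prime_gt0 pp)) star_half_tail.
have p2 : (0 < 2 < p)%N by apply/andP; split=> //; apply: leq_ltn_trans mp'.
have h : (2 ^- p.-1 - 1) * X \in pmult p 2.
  by apply: (pmultM p 1 1) => //; exact: pmult_fermatV.
apply: pmult_eq (rpredB h (pmultMl _ _ _ _ (i2 p.-1) H)) _.
by rewrite ?(prednK m0); ring.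
Qed.

Theorem theorem1p5 (m : nat) (m_gt0 : (0 < m)%N) (m_even : ~~ odd m) :
  polylog_star_half m =
  A2_of_rat (fun p : nat =>
    (2 ^+ m.+1 - 1) / 2 ^+ m.+1 *
    (bernoulli (p - m - 1)%N / (m.+1)%:R) * p%:R) :> A2.
Proof.
apply/A2_eqP.
apply: (@sub_finite_set _ _ ((val : primeIdx -> nat) @^-1` `I_(2 ^ m + m.+2).+1)%classic).
  move=> p /= neq; rewrite ltnNge; apply/negP => lt; apply: neq.
  have [X1 D] := polylog_star_half_congr (val p) m (valP p) m_gt0 m_even lt.
  have p0 := prime_gt0 (valP p).
  apply: ratr_Zp2_eq => //; first exact: (valP p); last exact: pmultW.
  rewrite -[X in X \in _](subrK ((2 ^+ m.+1 - 1) / 2 ^+ m.+1 *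
    (bernoulli (val p - m - 1) / m.+1%:R) * (val p)%:R)).
  apply: rpredD; last exact: pmultW.
  by apply: pmultW => //; apply: pmultW.
apply: finite_preimage; last exact: finite_II.
by move=> p q _ _; exact: val_inj.
Qed.
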